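(* Let $\tilde\alpha=\tilde\alpha(\bar s)$ be a unit speed regular dual curve on the dual unit sphere $\tilde S^2$ with dual Darboux frame $\{\tilde e,\tilde t,\tilde g\}$ and dual spherical curvature $\bar\gamma$, and let $\tilde\alpha_4=\frac{1}{\sqrt3}(\tilde e+\tilde t+\tilde g)$ be its dual Smarandache $\tilde e\tilde t\tilde g$-curve, with dual spherical curvature $\bar\gamma_4$. Then $$\bar\gamma_4=\frac{3\bar\gamma'+2\bar\gamma^3+2}{2\sqrt2\,(\bar\gamma^2-\bar\gamma+1)^{3/2}} .$$
   Context: Dual numbers are $\bar a=a+\varepsilon a^*$ with $a,a^*\in\mathbb R$, $\varepsilon^2=0$; a differentiable real function is extended by $f(x+\varepsilon x^* )=f(x)+\varepsilon x^*f'(x)$. Dual vectors are $\tilde a=\vec a+\varepsilon\vec a^*$, $\vec a,\vec a^*\in\mathbb R^3$, with $\langle\tilde a,\tilde b\rangle=\langle\vec a,\vec b\rangle+\varepsilon(\langle\vec a,\vec b^*\rangle+\langle\vec a^*,\vec b\rangle)$, $\tilde a\times\tilde b=\vec a\times\vec b+\varepsilon(\vec a\times\vec b^*+\vec a^*\times\vec b)$, and norm $\|\tilde a\|=\|\vec a\|+\varepsilon\langle\vec a,\vec a^*\rangle/\|\vec a\|$ ($\vec a\ne0$). The dual unit sphere $\tilde S^2$ is the set of dual vectors with $\langle\tilde a,\tilde a\rangle=1+\varepsilon0$. Curves are smooth. For a regular dual curve on $\tilde S^2$ with position vector $\tilde e=\tilde\alpha$, $s$ denotes arc-length of the real part $\vec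 e$ (the real indicatrix), and the dual arc-length is $\bar s=\int\|d\tilde e/ds\|\,ds$; ''unit speed'' means that $\bar s$ is used as parameter, and $dF/d\bar s=(dF/ds)/(d\bar s/ds)$. The dual Darboux frame is $\tilde e$, $\tilde t=d\tilde e/d\bar s$, $\tilde g=\tilde e\times\tilde t$, and the dual spherical curvature $\bar\gamma$ is defined by $$\frac{d\tilde e}{d\bar s}=\tilde t,\quad \frac{d\tilde t}{d\bar s}=\bar\gamma\tilde g-\tilde e,\quad \frac{d\tilde g}{d\bar s}=-\bar\gamma\tilde t .$$ Here $\bar\gamma'=d\bar\gamma/d\bar s$. The quantities $\bar s_4,\tilde e_4=\tilde\alpha_4,\tilde t_4,\tilde g_4,\bar\gamma_4$ are the corresponding objects for $\tilde\alpha_4$ (a dual curve on $\tilde S^2$). *)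

(* Defs.v *)
From Stdlib Require Import Reals.
From Coquelicot Require Import Coquelicot.

Set Implicit Arguments.
Unset Strict Implicit.
Unset Printing Implicit Defensive.

Open Scope R_scope.

(* Euclidean 3-space *)

Record vec3 : Type := Vec3 { vx : R; vy : R; vz : R }.

Definition vadd (a b : vec3) : vec3 :=
  Vec3 (vx a + vx b) (vy a + vy b) (vz a + vz b).
Definition vscal (k : R) (a : vec3) : vec3 :=
  Vec3 (k * vx a) (k * vy a) (k * vz a).
Definition vdot (a b : vec3) : R := vx a * vx b + vy a * vy b + vz a * vz b.
Definition vcross (a b : vec3) : vec3 :=
  Vec3 (vy a * vz b - vz a * vy b)
       (vz a * vx b - vx a * vz b)
       (vx a * vy b - vy a * vx b).
Definition vnorm (a : vec3) : R := sqrt (vdot a a).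
Definition vzero : vec3 := Vec3 0 0 0.

(* [Dual a a'] is a + eps a', with eps^2 = 0. *)

Record dual (A : Type) : Type := Dual { re : A; du : A }.

Definition dnum : Type := dual R.
Definition dvec : Type := dual vec3.

Definition RtoD (x : R) : dnum := Dual x 0.
Definition dadd (a b : dnum) : dnum := Dual (re a + re b) (du a + du b).
Definition dopp (a : dnum) : dnum := Dual (- re a) (- du a).
Definition dsub (a b : dnum) : dnum := dadd a (dopp b).
Definition dmul (a b : dnum) : dnum :=
  Dual (re a * re b) (re a * du b + du a * re b).
Fixpoint dpow (a : dnum) (n : nat) : dnum :=
  match n with O => RtoD 1 | S m => dmul a (dpow a m) end.

(* f (x + eps x') = f x + eps x' f'(x); meant for f differentiable at x. *)
Definition dlift (f : R -> R) (x : dnum) : dnum :=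
  Dual (f (re x)) (du x * Derive f (re x)).

(* meaningful when the real part is nonzero *)
Definition dinv (a : dnum) : dnum := dlift Rinv a.
Definition ddiv (a b : dnum) : dnum := dmul a (dinv b).

(* meaningful when the real part is positive *)
Definition dRpower (a : dnum) (r : R) : dnum := dlift (fun x => Rpower x r) a.

Definition dvadd (a b : dvec) : dvec :=
  Dual (vadd (re a) (re b)) (vadd (du a) (du b)).
Definition dvscal (k : dnum) (a : dvec) : dvec :=
  Dual (vscal (re k) (re a))
       (vadd (vscal (re k) (du a)) (vscal (du k) (re a))).
Definition dvopp (a : dvec) : dvec := dvscal (RtoD (-1)) a.
Definition dvsub (a b : dvec) : dvec := dvadd a (dvopp b).
Definition dvdot (a b : dvec) : dnum :=
  Dual (vdot (re a) (re b)) (vdot (re a) (du b) + vdot (du a) (re b)).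
Definition dvcross (a b : dvec) : dvec :=
  Dual (vcross (re a) (re b))
       (vadd (vcross (re a) (du b)) (vcross (du a) (re b))).

(* meaningful when the real part is nonzero *)
Definition dvnorm (a : dvec) : dnum :=
  Dual (vnorm (re a)) (vdot (re a) (du a) / vnorm (re a)).

Definition on_dual_sphere (a : dvec) : Prop := dvdot a a = RtoD 1.

Declare Scope dual_scope.
Delimit Scope dual_scope with D.
Notation "x + y" := (dadd x y) : dual_scope.
Notation "x - y" := (dsub x y) : dual_scope.
Notation "- x" := (dopp x) : dual_scope.
Notation "x * y" := (dmul x y) : dual_scope.
Notation "x / y" := (ddiv x y) : dual_scope.
Notation "x ^ n" := (dpow x n) : dual_scope.

(* Derivatives with respect to a real parameter, taken coordinatewise *)

Definition vderive (F : R -> vec3) (u : R) : vec3 :=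
  Vec3 (Derive (fun v => vx (F v)) u)
       (Derive (fun v => vy (F v)) u)
       (Derive (fun v => vz (F v)) u).
Definition dderive (F : R -> dnum) (u : R) : dnum :=
  Dual (Derive (fun v => re (F v)) u) (Derive (fun v => du (F v)) u).
Definition dvderive (F : R -> dvec) (u : R) : dvec :=
  Dual (vderive (fun v => re (F v)) u) (vderive (fun v => du (F v)) u).

(* Everything is expressed in one real parameter u ranging over an open
   interval (possibly unbounded).  The arc-length s of the real indicatrix and
   the dual arc-length sb are functions of u, and the derivatives with respect
   to them are
     dF/ds = (dF/du) / (ds/du),   dF/dsb = (dF/ds) / (dsb/ds).
   Taking u = s is allowed.  This lets a curve and a second curve built from
   its frame share u while each is differentiated in its own arc-length. *)

Definition in_itv (a b : Rbar) (u : R) : Prop := Rbar_lt a u /\ Rbar_lt u b.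

Definition dds (s : R -> R) (F : R -> dnum) (u : R) : dnum :=
  ddiv (dderive F u) (RtoD (Derive s u)).
Definition dvds (s : R -> R) (F : R -> dvec) (u : R) : dvec :=
  dvscal (dinv (RtoD (Derive s u))) (dvderive F u).

Definition ddsb (s : R -> R) (sb : R -> dnum) (F : R -> dnum) (u : R) : dnum :=
  ddiv (dds s F u) (dds s sb u).
Definition dvdsb (s : R -> R) (sb : R -> dnum) (F : R -> dvec) (u : R) : dvec :=
  dvscal (dinv (dds s sb u)) (dvds s F u).

Definition smooth_on (a b : Rbar) (f : R -> R) : Prop :=
  forall (n : nat) (u : R), in_itv a b u -> ex_derive_n f n u.

Definition vsmooth_on (a b : Rbar) (F : R -> vec3) : Prop :=
  smooth_on a b (fun u => vx (F u)) /\
  smooth_on a b (fun u => vy (F u)) /\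
  smooth_on a b (fun u => vz (F u)).

Definition dvsmooth_on (a b : Rbar) (F : R -> dvec) : Prop :=
  vsmooth_on a b (fun u => re (F u)) /\ vsmooth_on a b (fun u => du (F u)).

(* Regular means that the real indicatrix is regular: this is what makes its
   arc-length a parameter and the dual norm of the velocity defined. *)
Record regular_dual_spherical_curve (a b : Rbar) (e : R -> dvec) : Prop := {
  rdsc_smooth  : dvsmooth_on a b e;
  rdsc_sphere  : forall u, in_itv a b u -> on_dual_sphere (e u);
  rdsc_regular : forall u, in_itv a b u ->
                   vderive (fun v => re (e v)) u <> vzero
}.

(* s is the arc-length of the real part, up to an additive constant. *)
Definition is_real_arclength (a b : Rbar) (e : R -> dvec) (s : R -> R) : Prop :=
  forall u, in_itv a b u ->
    is_derive s u (vnorm (vderive (fun v => re (e v)) u)).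

(* sb is an indefinite integral of ||de/ds|| ds. *)
Definition is_dual_arclength (a b : Rbar) (e : R -> dvec)
    (s : R -> R) (sb : R -> dnum) : Prop :=
  forall u, in_itv a b u ->
    ex_derive (fun v => re (sb v)) u /\
    ex_derive (fun v => du (sb v)) u /\
    dds s sb u = dvnorm (dvds s e u).

Record dual_darboux (a b : Rbar) (e : R -> dvec) (s : R -> R) (sb : R -> dnum)
    (t g : R -> dvec) (gamma : R -> dnum) : Prop := {
  dd_s   : is_real_arclength a b e s;
  dd_sb  : is_dual_arclength a b e s sb;
  dd_g   : forall u, in_itv a b u -> g u = dvcross (e u) (t u);
  dd_de  : forall u, in_itv a b u -> dvdsb s sb e u = t u;
  dd_dt  : forall u, in_itv a b u ->
             dvdsb s sb t u = dvsub (dvscal (gamma u) (g u)) (e u);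
  dd_dg  : forall u, in_itv a b u ->
             dvdsb s sb g u = dvopp (dvscal (gamma u) (t u))
}.

Definition smarandache_etg (e t g : R -> dvec) (u : R) : dvec :=
  dvscal (RtoD (1 / sqrt 3)) (dvadd (dvadd (e u) (t u)) (g u)).

(* Main.v *)
Require Import Defs.
From Stdlib Require Import Reals Lra.
From Coquelicot Require Import Coquelicot.

(* The dual numbers form a commutative ring in which an element with positive real part
   is invertible and determined by its square, so the classical computation carries over.
   With V = dsb/du the dual norm of de/du, the real arc-length drops out and the Darboux
   equations give gamma * V^3 = det(e, e', e''), primes being d/du.  Applied to e, this
   shows that gamma is differentiable.  Applied to e4 = k (e + t + g), 3 k^2 = 1, where
   e4' = k V (- e + (1 - gamma) t + gamma g), it gives
     gamma4 * V4^3 = (k V)^3 (3 dgamma/dsb + 2 gamma^3 + 2),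
   while V4^2 = 2 (k V)^2 (gamma^2 - gamma + 1). *)

Set Implicit Arguments.
Unset Strict Implicit.
Unset Printing Implicit Defensive.

(** * Arithmetic of dual numbers *)

Lemma dual_ext (A : Type) (x y : dual A) : re x = re y -> du x = du y -> x = y.
Proof. destruct x, y; simpl; intros -> ->; reflexivity. Qed.

Lemma dnum_ring_theory :
  ring_theory (RtoD 0) (RtoD 1) dadd dmul dsub dopp (@eq dnum).
Proof.
constructor; intros; apply dual_ext; simpl; ring.
Qed.

Add Ring dnum_ring : dnum_ring_theory.

Local Open Scope dual_scope.

Lemma RtoD_plus (x y : R) : RtoD (x + y)%R = RtoD x + RtoD y.
Proof. apply dual_ext; simpl; ring. Qed.

Lemma RtoD_mult (x y : R) : RtoD (x * y)%R = RtoD x * RtoD y.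
Proof. apply dual_ext; simpl; ring. Qed.

(** A closed form free of [Derive], so that inverses can be computed with and differentiated. *)
Lemma dinvE (x : dnum) : re x <> 0%R ->
  dinv x = Dual (/ re x)%R (- du x / (re x * re x))%R.
Proof.
intros hx; apply dual_ext; [reflexivity | simpl].
replace (Derive Rinv (re x)) with (- / (re x * re x))%R; [field; exact hx |].
symmetry; apply is_derive_unique; auto_derive; [exact hx | field; exact hx].
Qed.

Lemma dinv_l (x : dnum) : re x <> 0%R -> dinv x * x = RtoD 1.
Proof.
intros hx; rewrite (dinvE hx); apply dual_ext; simpl; field; exact hx.
Qed.

Lemma dinv_mul (x y : dnum) : re x <> 0%R -> re y <> 0%R ->
  dinv (x * y) = dinv x * dinv y.
Proof.
intros hx hy; assert (hxy : re (x * y) <> 0%R).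
{ simpl; apply Rmult_integral_contrapositive_currified; assumption. }
rewrite (dinvE hx), (dinvE hy), (dinvE hxy); apply dual_ext; simpl; field; auto.
Qed.

(** Pure dual parts are zero divisors, so cancellation goes through the inverse of [c], which exists
    because its real part is nonzero. *)
Lemma dmul_reg_l (c x y : dnum) : re c <> 0%R -> c * x = c * y -> x = y.
Proof.
intros hc h.
transitivity (dinv c * c * x); [rewrite (dinv_l hc); ring |].
transitivity (dinv c * (c * x)); [ring |].
rewrite h; transitivity (dinv c * c * y); [ring |].
rewrite (dinv_l hc); ring.
Qed.

(** The dual part of a square is [2 * re x * du x]: once the real parts agree by positivity, it
    determines [du x]. This lets norms and 3/2 powers be compared through their squares. *)
Lemma dsquare_inj (x y : dnum) : (0 < re x)%R -> (0 < re y)%R ->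
  x * x = y * y -> x = y.
Proof.
intros hx hy h.
assert (h1 := f_equal (@re R) h); assert (h2 := f_equal (@du R) h); simpl in h1, h2.
assert (hre : re x = re y) by (apply Rsqr_inj; unfold Rsqr; lra).
apply dual_ext; [exact hre |].
rewrite hre in h2; apply Rmult_eq_reg_l with (re y); lra.
Qed.

Lemma dRpower_three_halves_square (x : dnum) : (0 < re x)%R ->
  dRpower x (3 / 2) * dRpower x (3 / 2) = x * x * x.
Proof.
intros hx.
(* All powers are expressed through the square root of [re x], whose square is then eliminated. *)
assert (hd : Derive (fun y => Rpower y (3 / 2)) (re x)
             = (3 / 2 * Rpower (re x) (1 / 2))%R).
{ apply is_derive_unique, is_derive_Reals.
  replace (1 / 2)%R with (3 / 2 - 1)%R by field.
  apply derivable_pt_lim_power; exact hx. }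
assert (h3 : Rpower (re x) (3 / 2) = (re x * Rpower (re x) (1 / 2))%R).
{ replace (3 / 2)%R with (1 + 1 / 2)%R by field.
  rewrite Rpower_plus, Rpower_1 by exact hx; reflexivity. }
assert (h2 : (Rpower (re x) (1 / 2) * Rpower (re x) (1 / 2))%R = re x).
{ rewrite <- Rpower_plus; replace (1 / 2 + 1 / 2)%R with 1%R by field.
  apply Rpower_1; exact hx. }
apply dual_ext; simpl; rewrite ?hd, ?h3.
- transitivity (re x * re x * (Rpower (re x) (1 / 2) * Rpower (re x) (1 / 2)))%R; [ring |].
  rewrite h2; ring.
- transitivity (3 * re x * du x * (Rpower (re x) (1 / 2) * Rpower (re x) (1 / 2)))%R; [field |].
  rewrite h2; ring.
Qed.

(** * Dual vectors as triples of dual coordinates *)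

Definition dvx (a : dvec) : dnum := Dual (vx (re a)) (vx (du a)).
Definition dvy (a : dvec) : dnum := Dual (vy (re a)) (vy (du a)).
Definition dvz (a : dvec) : dnum := Dual (vz (re a)) (vz (du a)).

Lemma dvec_ext (p q : dvec) : dvx p = dvx q -> dvy p = dvy q -> dvz p = dvz q -> p = q.
Proof.
destruct p as [[? ? ?] [? ? ?]], q as [[? ? ?] [? ? ?]]; unfold dvx, dvy, dvz; simpl.
intros h1 h2 h3; injection h1; injection h2; injection h3; intros; subst; reflexivity.
Qed.

Lemma dvdotE (p q : dvec) : dvdot p q = dvx p * dvx q + dvy p * dvy q + dvz p * dvz q.
Proof. apply dual_ext; simpl; unfold vdot; ring. Qed.

Lemma dvx_add p q : dvx (dvadd p q) = dvx p + dvx q. Proof. reflexivity. Qed.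
Lemma dvy_add p q : dvy (dvadd p q) = dvy p + dvy q. Proof. reflexivity. Qed.
Lemma dvz_add p q : dvz (dvadd p q) = dvz p + dvz q. Proof. reflexivity. Qed.
Lemma dvx_scal k p : dvx (dvscal k p) = k * dvx p. Proof. reflexivity. Qed.
Lemma dvy_scal k p : dvy (dvscal k p) = k * dvy p. Proof. reflexivity. Qed.
Lemma dvz_scal k p : dvz (dvscal k p) = k * dvz p. Proof. reflexivity. Qed.
Lemma dvx_cross p q : dvx (dvcross p q) = dvy p * dvz q - dvz p * dvy q.
Proof. apply dual_ext; simpl; ring. Qed.
Lemma dvy_cross p q : dvy (dvcross p q) = dvz p * dvx q - dvx p * dvz q.
Proof. apply dual_ext; simpl; ring. Qed.
Lemma dvz_cross p q : dvz (dvcross p q) = dvx p * dvy q - dvy p * dvx q.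
Proof. apply dual_ext; simpl; ring. Qed.

Ltac dvec_simpl :=
  unfold dvsub, dvopp;
  rewrite ?dvdotE, ?dvx_add, ?dvy_add, ?dvz_add, ?dvx_scal, ?dvy_scal, ?dvz_scal,
    ?dvx_cross, ?dvy_cross, ?dvz_cross, ?dvx_add, ?dvy_add, ?dvz_add,
    ?dvx_scal, ?dvy_scal, ?dvz_scal.

Lemma RtoD_opp1 : RtoD (-1) = - RtoD 1.
Proof. apply dual_ext; simpl; ring. Qed.

(** Reduces an identity of dual vectors to polynomial identities over the dual numbers. [dvopp]
    scales by [RtoD (-1)], which [ring] would take for an atom unless it is rewritten. *)
Ltac dvec_ring :=
  intros; try apply dvec_ext; repeat progress dvec_simpl; rewrite ?RtoD_opp1; ring.

Definition dvdet (p q r : dvec) : dnum := dvdot (dvcross p q) r.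

Definition dvcomb (p q r : dvec) (x y z : dnum) : dvec :=
  dvadd (dvadd (dvscal x p) (dvscal y q)) (dvscal z r).

(** Multiplicativity of the determinant: the first factor is the determinant of the coefficient
    matrix. *)
Lemma dvdet_comb (p q r : dvec) (x1 x2 x3 y1 y2 y3 z1 z2 z3 : dnum) :
  dvdet (dvcomb p q r x1 x2 x3) (dvcomb p q r y1 y2 y3) (dvcomb p q r z1 z2 z3)
  = ((x2 * y3 - x3 * y2) * z1 + (x3 * y1 - x1 * y3) * z2 + (x1 * y2 - x2 * y1) * z3)
    * dvdet p q r.
Proof. unfold dvdet, dvcomb; dvec_ring. Qed.

Lemma dvdot_comb (p q r : dvec) (x1 x2 x3 y1 y2 y3 : dnum) :
  dvdot (dvcomb p q r x1 x2 x3) (dvcomb p q r y1 y2 y3)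
  = x1 * y1 * dvdot p p + x2 * y2 * dvdot q q + x3 * y3 * dvdot r r
    + (x1 * y2 + x2 * y1) * dvdot p q + (x1 * y3 + x3 * y1) * dvdot p r
    + (x2 * y3 + x3 * y2) * dvdot q r.
Proof. unfold dvcomb; dvec_ring. Qed.

(** Lagrange's identity. *)
Lemma dvdot_cross_cross (p q : dvec) :
  dvdot (dvcross p q) (dvcross p q) = dvdot p p * dvdot q q - dvdot p q * dvdot p q.
Proof. dvec_ring. Qed.

Lemma dvdot_cross_l (p q : dvec) : dvdot p (dvcross p q) = RtoD 0.
Proof. dvec_ring. Qed.

Lemma dvdot_cross_r (p q : dvec) : dvdot q (dvcross p q) = RtoD 0.
Proof. dvec_ring. Qed.

(** * Norms of vectors and of dual vectors *)

Lemma vdot_self_pos (p : vec3) : p <> vzero -> (0 < vdot p p)%R.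
Proof.
destruct p as [x y z]; unfold vdot, vzero; simpl; intros h.
destruct (Req_dec x 0) as [hx | hx]; destruct (Req_dec y 0) as [hy | hy];
  destruct (Req_dec z 0) as [hz | hz]; try (exfalso; apply h; subst; reflexivity);
  assert (Hx := Rle_0_sqr x); assert (Hy := Rle_0_sqr y); assert (Hz := Rle_0_sqr z);
  try (assert (Hx' := Rsqr_pos_lt x hx)); try (assert (Hy' := Rsqr_pos_lt y hy));
  try (assert (Hz' := Rsqr_pos_lt z hz)); unfold Rsqr in *; lra.
Qed.

Lemma vnorm_pos (p : vec3) : p <> vzero -> (0 < vnorm p)%R.
Proof. intros h; apply sqrt_lt_R0, vdot_self_pos, h. Qed.

Lemma dvnorm_square (p : dvec) : re p <> vzero -> dvnorm p * dvnorm p = dvdot p p.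
Proof.
intros h; assert (hp := vnorm_pos h); assert (hd := vdot_self_pos h).
apply dual_ext; simpl.
- unfold vnorm; apply sqrt_sqrt; lra.
- transitivity (2 * vdot (re p) (du p))%R; [field; lra | unfold vdot; ring].
Qed.

Lemma vnorm_scal (k : R) (p : vec3) : (0 < k)%R -> vnorm (vscal k p) = (k * vnorm p)%R.
Proof.
intros hk; unfold vnorm.
replace (vdot (vscal k p) (vscal k p)) with ((k * k) * vdot p p)%R
  by (unfold vdot; simpl; ring).
rewrite sqrt_mult_alt by nra; rewrite sqrt_square by lra; reflexivity.
Qed.

(** Meant for the passage from de/du to de/ds, where the factor is the positive real number 1 /
    (ds/du). *)
Lemma dvnorm_scal_real (k : R) (p : dvec) : (0 < k)%R -> re p <> vzero ->
  dvnorm (dvscal (RtoD k) p) = RtoD k * dvnorm p.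
Proof.
intros hk h; assert (hp := vnorm_pos h).
apply dual_ext; simpl; rewrite vnorm_scal by exact hk; [reflexivity |].
transitivity (k * (k * vdot (re p) (du p)) / (k * vnorm (re p)))%R.
- unfold vdot; simpl; unfold Rdiv; ring.
- field; lra.
Qed.

(** * Differentiation of dual-valued functions *)

Definition is_dderive (F : R -> dnum) (u : R) (l : dnum) : Prop :=
  is_derive (fun v => re (F v)) u (re l) /\ is_derive (fun v => du (F v)) u (du l).

Definition ex_dderive (F : R -> dnum) (u : R) : Prop := exists l, is_dderive F u l.

Lemma is_dderive_unique (F : R -> dnum) (u : R) (l : dnum) :
  is_dderive F u l -> dderive F u = l.
Proof.
intros [h1 h2]; apply dual_ext; simpl; apply is_derive_unique; assumption.
Qed.

(** [Derive] returns a value even where no derivative exists, so [dderive] is trusted only together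
    with a proof of existence. *)
Lemma ex_dderive_correct (F : R -> dnum) (u : R) :
  ex_dderive F u -> is_dderive F u (dderive F u).
Proof. intros [l hl]; rewrite (is_dderive_unique hl); exact hl. Qed.

Lemma is_dderive_const (c : dnum) (u : R) : is_dderive (fun _ => c) u (RtoD 0).
Proof. split; simpl; exact (is_derive_const _ u). Qed.

Lemma is_dderive_add (F G : R -> dnum) (u : R) (l m : dnum) :
  is_dderive F u l -> is_dderive G u m -> is_dderive (fun v => F v + G v) u (l + m).
Proof.
intros [h1 h2] [h3 h4]; split; simpl;
  apply (@is_derive_plus R_AbsRing R_NormedModule); assumption.
Qed.

Lemma is_derive_mul_R (f g : R -> R) (u l m : R) :
  is_derive f u l -> is_derive g u m ->
  is_derive (fun v => f v * g v)%R u (l * g u + f u * m)%R.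
Proof. intros h1 h2; apply (is_derive_mult f g u l m h1 h2 Rmult_comm). Qed.

Lemma is_dderive_mul (F G : R -> dnum) (u : R) (l m : dnum) :
  is_dderive F u l -> is_dderive G u m ->
  is_dderive (fun v => F v * G v) u (l * G u + F u * m).
Proof.
intros [h1 h2] [h3 h4]; split; simpl.
- apply is_derive_mul_R; assumption.
- replace (re l * du (G u) + du l * re (G u) + (re (F u) * du m + du (F u) * re m))%R
    with ((re l * du (G u) + re (F u) * du m) + (du l * re (G u) + du (F u) * re m))%R
    by ring.
  apply (@is_derive_plus R_AbsRing R_NormedModule); apply is_derive_mul_R; assumption.
Qed.

Lemma is_dderive_opp (F : R -> dnum) (u : R) (l : dnum) :
  is_dderive F u l -> is_dderive (fun v => - F v) u (- l).
Proof.
intros [h1 h2]; split; simpl;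
  apply (@is_derive_opp R_AbsRing R_NormedModule); assumption.
Qed.

Lemma is_dderive_sub (F G : R -> dnum) (u : R) (l m : dnum) :
  is_dderive F u l -> is_dderive G u m -> is_dderive (fun v => F v - G v) u (l - m).
Proof.
intros h1 h2; apply is_dderive_add; [exact h1 | apply is_dderive_opp, h2].
Qed.

Lemma in_itv_locally (a b : Rbar) (u : R) : in_itv a b u -> locally u (in_itv a b).
Proof.
intros [h1 h2]; apply filter_and; [exact (open_Rbar_gt' _ _ h1) | exact (open_Rbar_lt' _ _ h2)].
Qed.

(** The frame equations are known on the interval only; as it is open, agreement there is agreement
    near [u]. *)
Lemma is_dderive_ext_itv (a b : Rbar) (F G : R -> dnum) (u : R) (l : dnum) :
  in_itv a b u -> (forall v, in_itv a b v -> F v = G v) ->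
  is_dderive G u l -> is_dderive F u l.
Proof.
intros hu hFG [h1 h2]; split; eapply is_derive_ext_loc; try eassumption;
  generalize (in_itv_locally hu); apply filter_imp; intros v hv; simpl;
  rewrite (hFG v hv); reflexivity.
Qed.

Lemma ex_dderiveP (F : R -> dnum) (u : R) :
  ex_derive (fun v => re (F v)) u -> ex_derive (fun v => du (F v)) u -> ex_dderive F u.
Proof. intros [l hl] [m hm]; exists (Dual l m); split; assumption. Qed.

Lemma ex_dderive_dinv (a b : Rbar) (F : R -> dnum) (u : R) : in_itv a b u ->
  (forall v, in_itv a b v -> re (F v) <> 0%R) ->
  ex_dderive F u -> ex_dderive (fun v => dinv (F v)) u.
Proof.
intros hu hF [l [h1 h2]].
(* The closed form of the inverse is differentiated, then transported to [dinv] on the interval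
   where the real part is nonzero. *)
assert (h : ex_dderive
  (fun v => Dual (/ re (F v))%R (- du (F v) / (re (F v) * re (F v)))%R) u).
{ assert (hR : forall f g : R -> R, f u <> 0%R -> ex_derive f u -> ex_derive g u ->
    ex_derive (fun v => / f v)%R u /\ ex_derive (fun v => - g v / (f v * f v))%R u)
    by (intros f g hf h3 h4; split; auto_derive; repeat split; auto;
      apply Rmult_integral_contrapositive_currified; assumption).
  destruct (hR (fun v => re (F v)) (fun v => du (F v)) (hF u hu)) as [h3 h4];
    [eexists; eassumption | eexists; eassumption |].
  apply ex_dderiveP; assumption. }
destruct h as [m hm]; exists m; apply (is_dderive_ext_itv hu) with (2 := hm).
intros v hv; apply dinvE, hF, hv.
Qed.

(** * Differentiation of dual vector functions *)

Definition is_dvderive (F : R -> dvec) (u : R) (l : dvec) : Prop :=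
  is_dderive (fun v => dvx (F v)) u (dvx l) /\
  is_dderive (fun v => dvy (F v)) u (dvy l) /\
  is_dderive (fun v => dvz (F v)) u (dvz l).

Definition ex_dvderive (F : R -> dvec) (u : R) : Prop := exists l, is_dvderive F u l.

Lemma is_dvderive_unique (F : R -> dvec) (u : R) (l : dvec) :
  is_dvderive F u l -> dvderive F u = l.
Proof.
intros (h1 & h2 & h3); apply dvec_ext;
  [exact (is_dderive_unique h1) | exact (is_dderive_unique h2) | exact (is_dderive_unique h3)].
Qed.

Lemma ex_dvderive_correct (F : R -> dvec) (u : R) :
  ex_dvderive F u -> is_dvderive F u (dvderive F u).
Proof. intros [l hl]; rewrite (is_dvderive_unique hl); exact hl. Qed.

Lemma is_dvderive_eq (F : R -> dvec) (u : R) (l m : dvec) :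
  is_dvderive F u l -> l = m -> is_dvderive F u m.
Proof. intros h <-; exact h. Qed.

Lemma is_dvderive_ext_itv (a b : Rbar) (F G : R -> dvec) (u : R) (l : dvec) :
  in_itv a b u -> (forall v, in_itv a b v -> F v = G v) ->
  is_dvderive G u l -> is_dvderive F u l.
Proof.
intros hu hFG (h1 & h2 & h3); split; [| split];
  eapply (is_dderive_ext_itv hu); try eassumption; intros v hv; simpl;
  rewrite (hFG v hv); reflexivity.
Qed.

Lemma is_dvderive_add (F G : R -> dvec) (u : R) (l m : dvec) :
  is_dvderive F u l -> is_dvderive G u m ->
  is_dvderive (fun v => dvadd (F v) (G v)) u (dvadd l m).
Proof.
intros (h1 & h2 & h3) (k1 & k2 & k3); split; [| split];
  [exact (is_dderive_add h1 k1) | exact (is_dderive_add h2 k2) | exact (is_dderive_add h3 k3)].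
Qed.

Lemma is_dvderive_scal (k : R -> dnum) (F : R -> dvec) (u : R) (k' : dnum) (l : dvec) :
  is_dderive k u k' -> is_dvderive F u l ->
  is_dvderive (fun v => dvscal (k v) (F v)) u (dvadd (dvscal k' (F u)) (dvscal (k u) l)).
Proof.
intros hk (h1 & h2 & h3); split; [| split];
  [exact (is_dderive_mul hk h1) | exact (is_dderive_mul hk h2) | exact (is_dderive_mul hk h3)].
Qed.

Lemma is_dderive_dot (F G : R -> dvec) (u : R) (l m : dvec) :
  is_dvderive F u l -> is_dvderive G u m ->
  is_dderive (fun v => dvdot (F v) (G v)) u (dvdot l (G u) + dvdot (F u) m).
Proof.
intros (h1 & h2 & h3) (k1 & k2 & k3).
replace (dvdot l (G u) + dvdot (F u) m) with
  ((dvx l * dvx (G u) + dvx (F u) * dvx m) + (dvy l * dvy (G u) + dvy (F u) * dvy m)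
   + (dvz l * dvz (G u) + dvz (F u) * dvz m)) by dvec_ring.
assert (h := is_dderive_add (is_dderive_add (is_dderive_mul h1 k1) (is_dderive_mul h2 k2))
  (is_dderive_mul h3 k3)).
split; [eapply is_derive_ext, (proj1 h) | eapply is_derive_ext, (proj2 h)];
  intros v; rewrite dvdotE; reflexivity.
Qed.

Lemma is_dvderive_cross (F G : R -> dvec) (u : R) (l m : dvec) :
  is_dvderive F u l -> is_dvderive G u m ->
  is_dvderive (fun v => dvcross (F v) (G v)) u (dvadd (dvcross l (G u)) (dvcross (F u) m)).
Proof.
intros (h1 & h2 & h3) (k1 & k2 & k3).
assert (H : forall (f f' : R -> dnum) (c c' : dnum), (forall v, f v = f' v) -> c = c' ->
   is_dderive f u c -> is_dderive f' u c').
{ intros f f' c c' hf <- [d1 d2]; split;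
    [eapply is_derive_ext, d1 | eapply is_derive_ext, d2]; intros v; exact (f_equal _ (hf v)). }
split; [| split].
- eapply H; [intros v; symmetry; apply dvx_cross | |
    apply is_dderive_sub; [exact (is_dderive_mul h2 k3) | exact (is_dderive_mul h3 k2)]].
  dvec_ring.
- eapply H; [intros v; symmetry; apply dvy_cross | |
    apply is_dderive_sub; [exact (is_dderive_mul h3 k1) | exact (is_dderive_mul h1 k3)]].
  dvec_ring.
- eapply H; [intros v; symmetry; apply dvz_cross | |
    apply is_dderive_sub; [exact (is_dderive_mul h1 k2) | exact (is_dderive_mul h2 k1)]].
  dvec_ring.
Qed.

Lemma ex_dderive_dvnorm (F : R -> dvec) (u : R) :
  re (F u) <> vzero -> ex_dvderive F u -> ex_dderive (fun v => dvnorm (F v)) u.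
Proof.
intros hF [l hl]; assert (hp := vdot_self_pos hF).
destruct (is_dderive_dot hl hl) as [h1 h2]; simpl in h1, h2.
apply ex_dderiveP; simpl.
- unfold vnorm.
  assert (hR : forall f : R -> R, (0 < f u)%R -> ex_derive f u ->
    ex_derive (fun v => sqrt (f v)) u) by (intros f hf h3; auto_derive; auto).
  apply (hR (fun v => vdot (re (F v)) (re (F v)))); [exact hp | eexists; eassumption].
(* The dual part of [dvdot (F v) (F v)] is twice the product in the numerator of the dual norm,
   whence the 2 in the denominator. *)
- assert (hR : forall f g : R -> R, (0 < f u)%R -> ex_derive f u -> ex_derive g u ->
    ex_derive (fun v => g v / (2 * sqrt (f v)))%R u).
  { intros f g hf h3 h4; assert (hs := sqrt_lt_R0 _ hf); auto_derive; repeat split; auto; lra. }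
  assert (h3 := hR (fun v => vdot (re (F v)) (re (F v)))
    (fun v => vdot (re (F v)) (du (F v)) + vdot (du (F v)) (re (F v)))%R hp
    (ex_intro _ _ h1) (ex_intro _ _ h2)).
  eapply ex_derive_ext, h3; intros v; simpl; unfold vnorm.
  replace (vdot (du (F v)) (re (F v))) with (vdot (re (F v)) (du (F v)))
    by (unfold vdot; ring).
  unfold Rdiv; rewrite Rinv_mult; lra.
Qed.

(** * Consequences of smoothness *)

Lemma smooth_on_Derive (a b : Rbar) (f : R -> R) :
  smooth_on a b f -> smooth_on a b (Derive f).
Proof.
(* At order 0 [ex_derive_n] is [True]. Otherwise the n-th derivative of [Derive f] is the derivative
   of order n + 1 of [f]. *)
intros hf [| n] u hu; [exact I | simpl].
apply ex_derive_ext with (f := Derive_n f (S n)); [| exact (hf (S (S n)) u hu)].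
intros v; rewrite <- PeanoNat.Nat.add_1_r; exact (eq_sym (Derive_n_comp f n 1 v)).
Qed.

Lemma dvsmooth_on_dvderive (a b : Rbar) (F : R -> dvec) :
  dvsmooth_on a b F -> dvsmooth_on a b (dvderive F).
Proof.
intros [(h1 & h2 & h3) (h4 & h5 & h6)].
split; (split; [| split]); apply smooth_on_Derive; assumption.
Qed.

Lemma dvsmooth_on_ex_dvderive (a b : Rbar) (F : R -> dvec) (u : R) :
  dvsmooth_on a b F -> in_itv a b u -> ex_dvderive F u.
Proof.
intros [(h1 & h2 & h3) (h4 & h5 & h6)] hu.
destruct (h1 1%nat u hu) as [l1 d1], (h2 1%nat u hu) as [l2 d2],
  (h3 1%nat u hu) as [l3 d3], (h4 1%nat u hu) as [l4 d4],
  (h5 1%nat u hu) as [l5 d5], (h6 1%nat u hu) as [l6 d6].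
exists (Dual (Vec3 l1 l2 l3) (Vec3 l4 l5 l6)).
split; [| split]; split; assumption.
Qed.

(** A common interface for [e] and its Smarandache curve. Two derivatives suffice for the
    determinant formula, and for the second curve they and the regularity are deduced from the frame
    of the first. *)
Record twice_differentiable_spherical (a b : Rbar) (e : R -> dvec) : Prop := {
  tds_sphere : forall u, in_itv a b u -> dvdot (e u) (e u) = RtoD 1;
  tds_diff : forall u, in_itv a b u -> ex_dvderive e u;
  tds_diff2 : forall u, in_itv a b u -> ex_dvderive (dvderive e) u;
  tds_regular : forall u, in_itv a b u -> re (dvderive e u) <> vzero
}.

(** * Dual speed and elimination of the arc-lengths *)

Definition dspeed (e : R -> dvec) (u : R) : dnum := dvnorm (dvderive e u).

Lemma dspeed_pos (a b : Rbar) (e : R -> dvec) (u : R) :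
  twice_differentiable_spherical a b e -> in_itv a b u -> (0 < re (dspeed e u))%R.
Proof. intros he hu; exact (vnorm_pos (tds_regular he hu)). Qed.

(* The real parameters s and u drop out: dsb/du is the dual norm of de/du. *)
Lemma dual_arclength_dspeed (a b : Rbar) (e : R -> dvec) (s : R -> R) (sb : R -> dnum)
    (t g : R -> dvec) (gamma : R -> dnum) (u : R) :
  twice_differentiable_spherical a b e -> dual_darboux a b e s sb t g gamma ->
  in_itv a b u ->
  dinv (dds s sb u) * dinv (RtoD (Derive s u)) = dinv (dspeed e u).
Proof.
intros he hf hu; assert (hr := tds_regular he hu).
assert (hn : (0 < vnorm (re (dvderive e u)))%R) by exact (vnorm_pos hr).
assert (hs : Derive s u = vnorm (re (dvderive e u))) by exact (is_derive_unique _ _ _ (dd_s hf hu)).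
assert (hs0 : Derive s u <> 0%R) by lra.
assert (hi : dinv (RtoD (Derive s u)) = RtoD (/ Derive s u)%R).
{ rewrite dinvE by exact hs0; apply dual_ext; simpl; field; exact hs0. }
destruct (dd_sb hf hu) as (_ & _ & hsb).
assert (hV := dspeed_pos he hu).
(* Since de/ds is de/du divided by the positive real ds/du, its dual norm is the dual speed divided
   by the same number. *)
assert (hsb' : dds s sb u = RtoD (/ Derive s u)%R * dspeed e u).
{ rewrite hsb; unfold dvds; rewrite hi; apply dvnorm_scal_real; [| exact hr].
  apply Rinv_0_lt_compat; lra. }
assert (h1 : (0 < / Derive s u)%R) by (apply Rinv_0_lt_compat; lra).
assert (h2 : re (dds s sb u) <> 0%R).
{ rewrite hsb'; simpl; apply Rgt_not_eq, Rmult_lt_0_compat; assumption. }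
rewrite <- dinv_mul by (try exact h2; exact hs0).
rewrite hsb', <- hi.
f_equal; transitivity (dinv (RtoD (Derive s u)) * RtoD (Derive s u) * dspeed e u); [ring |].
rewrite dinv_l by exact hs0; ring.
Qed.

(** Turns frame equations in d/dsb into equations in d/du, the derivative that both curves share. *)
Lemma dvdsb_dspeed (a b : Rbar) (e : R -> dvec) (s : R -> R) (sb : R -> dnum)
    (t g : R -> dvec) (gamma : R -> dnum) (F : R -> dvec) (u : R) :
  twice_differentiable_spherical a b e -> dual_darboux a b e s sb t g gamma ->
  in_itv a b u -> dvderive F u = dvscal (dspeed e u) (dvdsb s sb F u).
Proof.
intros he hf hu; unfold dvdsb, dvds.
assert (hV := dspeed_pos he hu).
assert (h := dual_arclength_dspeed he hf hu).
assert (hi : dspeed e u * (dinv (dds s sb u) * dinv (RtoD (Derive s u))) = RtoD 1).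
{ rewrite h; transitivity (dinv (dspeed e u) * dspeed e u); [ring | apply dinv_l; lra]. }
transitivity (dvscal (dspeed e u * (dinv (dds s sb u) * dinv (RtoD (Derive s u)))) (dvderive F u));
  [rewrite hi |]; dvec_ring.
Qed.

Lemma ddsb_dspeed (a b : Rbar) (e : R -> dvec) (s : R -> R) (sb : R -> dnum)
    (t g : R -> dvec) (gamma : R -> dnum) (F : R -> dnum) (u : R) :
  twice_differentiable_spherical a b e -> dual_darboux a b e s sb t g gamma ->
  in_itv a b u -> dderive F u = dspeed e u * ddsb s sb F u.
Proof.
intros he hf hu; unfold ddsb, dds at 1, ddiv.
assert (hV := dspeed_pos he hu).
assert (h := dual_arclength_dspeed he hf hu).
transitivity (dderive F u * (dspeed e u * (dinv (dds s sb u) * dinv (RtoD (Derive s u)))));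
  [rewrite h | ring].
transitivity (dderive F u * (dinv (dspeed e u) * dspeed e u)); [| ring].
rewrite dinv_l by lra; ring.
Qed.

Lemma ex_dderive_dspeed (a b : Rbar) (e : R -> dvec) (u : R) :
  twice_differentiable_spherical a b e -> in_itv a b u -> ex_dderive (dspeed e) u.
Proof.
intros he hu; exact (ex_dderive_dvnorm (tds_regular he hu) (tds_diff2 he hu)).
Qed.

(** * The Darboux frame and the curvature as a determinant *)

Lemma dvdot_sphere_velocity (a b : Rbar) (e : R -> dvec) (u : R) :
  twice_differentiable_spherical a b e -> in_itv a b u ->
  dvdot (e u) (dvderive e u) = RtoD 0.
Proof.
intros he hu; assert (h := ex_dvderive_correct (tds_diff he hu)).
assert (h1 := is_dderive_unique (is_dderive_dot h h)).
(* Differentiating [dvdot (e v) (e v) = RtoD 1] gives twice the wanted product; the 2 is cancelled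
   afterwards. *)
assert (h0 : dderive (fun v => dvdot (e v) (e v)) u = RtoD 0).
{ apply is_dderive_unique; apply is_dderive_ext_itv with (1 := hu) (G := fun _ => RtoD 1);
    [exact (tds_sphere he) | apply is_dderive_const]. }
apply dmul_reg_l with (c := RtoD 2); [simpl; lra |].
replace 2%R with (1 + 1)%R by ring; rewrite RtoD_plus.
transitivity (RtoD 0); [rewrite <- h0, h1 |]; dvec_ring.
Qed.

(** What later computations use of the frame at one point: the Darboux equations in d/du with
    differentiability included, orthonormality and orientation. *)
Record dual_frame_facts (e t g : R -> dvec) (V gamma : R -> dnum) (u : R)
    : Prop := {
  dff_de : is_dvderive e u (dvscal (V u) (t u));
  dff_dt : is_dvderive t u (dvscal (V u) (dvsub (dvscal (gamma u) (g u)) (e u)));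
  dff_dg : is_dvderive g u (dvscal (V u) (dvopp (dvscal (gamma u) (t u))));
  dff_ee : dvdot (e u) (e u) = RtoD 1;
  dff_tt : dvdot (t u) (t u) = RtoD 1;
  dff_gg : dvdot (g u) (g u) = RtoD 1;
  dff_et : dvdot (e u) (t u) = RtoD 0;
  dff_eg : dvdot (e u) (g u) = RtoD 0;
  dff_tg : dvdot (t u) (g u) = RtoD 0;
  dff_det : dvdet (e u) (t u) (g u) = RtoD 1
}.

(** The equations of [dual_darboux] only relate values of [Derive]. Differentiability comes from
    writing t as e' / V and g as the cross product of e and t; orthonormality from the sphere
    equation, V^2 = <e', e'> and Lagrange's identity. *)
Lemma dual_darboux_frame_facts (a b : Rbar) (e : R -> dvec) (s : R -> R) (sb : R -> dnum)
    (t g : R -> dvec) (gamma : R -> dnum) (u : R) :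
  twice_differentiable_spherical a b e -> dual_darboux a b e s sb t g gamma ->
  in_itv a b u -> dual_frame_facts e t g (dspeed e) gamma u.
Proof.
intros he hf hu.
assert (hV := fun v hv => @dspeed_pos a b e v he hv).
assert (hV0 : forall v, in_itv a b v -> re (dspeed e v) <> 0%R)
  by (intros v hv; apply Rgt_not_eq, hV, hv).
assert (hde : forall v, in_itv a b v -> dvderive e v = dvscal (dspeed e v) (t v)).
{ intros v hv; rewrite (dvdsb_dspeed e he hf hv), (dd_de hf hv); reflexivity. }
assert (ht : forall v, in_itv a b v -> t v = dvscal (dinv (dspeed e v)) (dvderive e v)).
{ intros v hv; rewrite (hde v hv).
  transitivity (dvscal (dinv (dspeed e v) * dspeed e v) (t v)); [| dvec_ring].
  rewrite dinv_l by (apply hV0, hv); dvec_ring. }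
assert (hee := ex_dvderive_correct (tds_diff he hu)).
assert (hdt : ex_dvderive t u).
{ destruct (ex_dderive_dinv hu hV0 (ex_dderive_dspeed he hu)) as [i hi].
  eexists; apply (is_dvderive_ext_itv hu ht).
  exact (is_dvderive_scal hi (ex_dvderive_correct (tds_diff2 he hu))). }
assert (htt := ex_dvderive_correct hdt).
assert (hgg : ex_dvderive g u).
{ eexists; apply (is_dvderive_ext_itv hu (dd_g hf)); exact (is_dvderive_cross hee htt). }
assert (het : dvdot (e u) (t u) = RtoD 0).
{ rewrite (ht u hu); transitivity (dinv (dspeed e u) * dvdot (e u) (dvderive e u)); [dvec_ring |].
  rewrite (dvdot_sphere_velocity he hu); ring. }
assert (htn : dvdot (t u) (t u) = RtoD 1).
{ rewrite (ht u hu).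
  transitivity (dinv (dspeed e u) * dinv (dspeed e u) * dvdot (dvderive e u) (dvderive e u));
    [dvec_ring |].
  rewrite <- (dvnorm_square (tds_regular he hu)); fold (dspeed e u).
  transitivity ((dinv (dspeed e u) * dspeed e u) * (dinv (dspeed e u) * dspeed e u)); [ring |].
  rewrite dinv_l by (apply hV0, hu); ring. }
assert (hn : dvdot (g u) (g u) = RtoD 1).
{ rewrite (dd_g hf hu), dvdot_cross_cross, (tds_sphere he hu), htn, het; ring. }
constructor; auto.
- rewrite <- (hde u hu); exact hee.
- rewrite <- (dd_dt hf hu), <- (dvdsb_dspeed t he hf hu); exact htt.
- rewrite <- (dd_dg hf hu), <- (dvdsb_dspeed g he hf hu); exact (ex_dvderive_correct hgg).
- exact (tds_sphere he hu).
- rewrite (dd_g hf hu); apply dvdot_cross_l.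
- rewrite (dd_g hf hu); apply dvdot_cross_r.
- unfold dvdet; rewrite <- (dd_g hf hu); exact hn.
Qed.

Lemma spherical_curvature_det (a b : Rbar) (e : R -> dvec) (s : R -> R) (sb : R -> dnum)
    (t g : R -> dvec) (gamma : R -> dnum) (u : R) :
  twice_differentiable_spherical a b e -> dual_darboux a b e s sb t g gamma ->
  in_itv a b u ->
  gamma u * (dspeed e u * dspeed e u * dspeed e u)
  = dvdet (e u) (dvderive e u) (dvderive (dvderive e) u).
Proof.
intros he hf hu.
assert (hF := fun v hv => @dual_darboux_frame_facts a b e s sb t g gamma v he hf hv).
assert (hd := is_dvderive_scal (ex_dderive_correct (ex_dderive_dspeed he hu)) (dff_dt (hF u hu))).
(* As e' = V t on the whole interval, e'' = V' t + V^2 (gamma g - e). In det(e, V t, e'') only the g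
   component of e'' survives. *)
assert (hdd := is_dvderive_unique (is_dvderive_ext_itv hu
  (fun v hv => is_dvderive_unique (dff_de (hF v hv))) hd)).
rewrite hdd, (is_dvderive_unique (dff_de (hF u hu))).
transitivity (gamma u * (dspeed e u * dspeed e u * dspeed e u)
  * dvdet (e u) (t u) (g u)); [rewrite (dff_det (hF u hu)); ring |].
unfold dvdet; dvec_ring.
Qed.

(** The determinant formula exhibits gamma as det(e, e', e'') / V^3, which is differentiable once
    e'' is. *)
Lemma ex_dderive_spherical_curvature (a b : Rbar) (e : R -> dvec) (s : R -> R)
    (sb : R -> dnum) (t g : R -> dvec) (gamma : R -> dnum) (u : R) :
  twice_differentiable_spherical a b e -> dual_darboux a b e s sb t g gamma ->
  in_itv a b u -> ex_dvderive (dvderive (dvderive e)) u -> ex_dderive gamma u.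
Proof.
intros he hf hu h3.
assert (hV0 : forall v, in_itv a b v -> re (dspeed e v) <> 0%R)
  by (intros v hv; apply Rgt_not_eq, (dspeed_pos he hv)).
destruct (ex_dderive_dinv hu hV0 (ex_dderive_dspeed he hu)) as [i hi].
assert (hdet := is_dderive_dot (is_dvderive_cross (ex_dvderive_correct (tds_diff he hu))
  (ex_dvderive_correct (tds_diff2 he hu))) (ex_dvderive_correct h3)).
eexists; eapply (is_dderive_ext_itv hu);
  [| exact (is_dderive_mul hdet (is_dderive_mul hi (is_dderive_mul hi hi)))].
intros v hv; cbv beta.
change (dvdot _ _) with (dvdet (e v) (dvderive e v) (dvderive (dvderive e) v)).
rewrite <- (spherical_curvature_det he hf hv).
transitivity (gamma v * ((dinv (dspeed e v) * dspeed e v) * (dinv (dspeed e v) * dspeed e v)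
  * (dinv (dspeed e v) * dspeed e v))); [| ring].
rewrite dinv_l by (apply hV0, hv); ring.
Qed.

(** The terms in [V u] are the transposed matrix of the Darboux equations applied to the
    coefficients. *)
Lemma is_dvderive_frame_comb (e t g : R -> dvec) (V gamma : R -> dnum) (u : R)
    (x y z : R -> dnum) (x' y' z' : dnum) :
  dual_frame_facts e t g V gamma u ->
  is_dderive x u x' -> is_dderive y u y' -> is_dderive z u z' ->
  is_dvderive (fun v => dvcomb (e v) (t v) (g v) (x v) (y v) (z v)) u
    (dvcomb (e u) (t u) (g u) (x' - V u * y u) (y' + V u * x u - V u * gamma u * z u)
      (z' + V u * gamma u * y u)).
Proof.
intros hF hx hy hz.
eapply is_dvderive_eq.
- exact (is_dvderive_add (is_dvderive_add (is_dvderive_scal hx (dff_de hF))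
    (is_dvderive_scal hy (dff_dt hF))) (is_dvderive_scal hz (dff_dg hF))).
- unfold dvcomb; dvec_ring.
Qed.

Lemma dvdot_frame_comb (e t g : R -> dvec) (V gamma : R -> dnum) (u : R)
    (x1 x2 x3 y1 y2 y3 : dnum) :
  dual_frame_facts e t g V gamma u ->
  dvdot (dvcomb (e u) (t u) (g u) x1 x2 x3) (dvcomb (e u) (t u) (g u) y1 y2 y3)
  = x1 * y1 + x2 * y2 + x3 * y3.
Proof.
intros hF; rewrite dvdot_comb, (dff_ee hF), (dff_tt hF), (dff_gg hF), (dff_et hF),
  (dff_eg hF), (dff_tg hF); ring.
Qed.

(** * The Smarandache curve in the frame of the original curve *)

Lemma smarandache_etg_comb (e t g : R -> dvec) (u : R) :
  smarandache_etg e t g u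
  = dvcomb (e u) (t u) (g u) (RtoD (1 / sqrt 3)) (RtoD (1 / sqrt 3)) (RtoD (1 / sqrt 3)).
Proof. unfold smarandache_etg, dvcomb; dvec_ring. Qed.

Lemma RtoD_inv_sqrt3_square :
  RtoD 3 * (RtoD (1 / sqrt 3) * RtoD (1 / sqrt 3)) = RtoD 1.
Proof.
rewrite <- !RtoD_mult; f_equal.
assert (h := sqrt_lt_R0 3 ltac:(lra)); assert (h2 := sqrt_sqrt 3 ltac:(lra)).
apply Rmult_eq_reg_r with (sqrt 3 * sqrt 3)%R; [| nra].
transitivity 3%R; [field; lra | lra].
Qed.

Lemma regular_twice_differentiable (a b : Rbar) (e : R -> dvec) :
  regular_dual_spherical_curve a b e -> twice_differentiable_spherical a b e.
Proof.
intros [h1 h2 h3]; constructor; [exact h2 | | | exact h3]; intros u hu.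
- exact (dvsmooth_on_ex_dvderive h1 hu).
- exact (dvsmooth_on_ex_dvderive (dvsmooth_on_dvderive h1) hu).
Qed.

Lemma RtoD_2 : RtoD 2 = RtoD 1 + RtoD 1.
Proof. exact (RtoD_plus 1 1). Qed.

Lemma RtoD_3 : RtoD 3 = RtoD 1 + RtoD 1 + RtoD 1.
Proof. rewrite <- !RtoD_plus; f_equal; ring. Qed.

Lemma is_dvderive_smarandache_etg (e t g : R -> dvec) (V gamma : R -> dnum) (u : R) :
  dual_frame_facts e t g V gamma u ->
  is_dvderive (smarandache_etg e t g) u
    (dvcomb (e u) (t u) (g u) (- (RtoD (1 / sqrt 3) * V u))
      (RtoD (1 / sqrt 3) * V u * (RtoD 1 - gamma u)) (RtoD (1 / sqrt 3) * V u * gamma u)).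
Proof.
intros hF; eapply is_dvderive_eq.
- exact (is_dvderive_scal (is_dderive_const (RtoD (1 / sqrt 3)) u)
    (is_dvderive_add (is_dvderive_add (dff_de hF) (dff_dt hF)) (dff_dg hF))).
- unfold dvcomb; dvec_ring.
Qed.

(** The product rule in the moving frame, applied to the coefficients -kV, kV(1 - gamma) and kV
    gamma of the velocity. *)
Lemma is_dvderive2_smarandache_etg (a b : Rbar) (e t g : R -> dvec) (V gamma : R -> dnum)
    (u : R) (V' gamma' : dnum) :
  (forall v, in_itv a b v -> dual_frame_facts e t g V gamma v) -> in_itv a b u ->
  is_dderive V u V' -> is_dderive gamma u gamma' ->
  let k := RtoD (1 / sqrt 3) in
  is_dvderive (dvderive (smarandache_etg e t g)) u
    (dvcomb (e u) (t u) (g u)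
      (- (k * V') - k * V u * V u * (RtoD 1 - gamma u))
      (k * V' * (RtoD 1 - gamma u)
       - k * V u * (gamma' + V u + V u * gamma u * gamma u))
      (k * V' * gamma u
       + k * V u * (gamma' + V u * gamma u * (RtoD 1 - gamma u)))).
Proof.
intros hF hu hV hg k.
assert (hk := is_dderive_mul (is_dderive_const k u) hV).
assert (h := is_dvderive_frame_comb (hF u hu) (is_dderive_opp hk)
  (is_dderive_mul hk (is_dderive_sub (is_dderive_const (RtoD 1) u) hg))
  (is_dderive_mul hk hg)).
eapply is_dvderive_eq.
- exact (is_dvderive_ext_itv hu
    (fun v hv => is_dvderive_unique (is_dvderive_smarandache_etg (hF v hv))) h).
- unfold dvcomb, k; dvec_ring.
Qed.

Lemma dvdot_smarandache_etg (e t g : R -> dvec) (V gamma : R -> dnum) (u : R) :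
  dual_frame_facts e t g V gamma u ->
  dvdot (smarandache_etg e t g u) (smarandache_etg e t g u) = RtoD 1.
Proof.
intros hF; rewrite smarandache_etg_comb, (dvdot_frame_comb _ _ _ _ _ _ hF).
rewrite <- RtoD_inv_sqrt3_square, RtoD_3; ring.
Qed.

(** By orthonormality the last factor comes from 1 + (1 - gamma)^2 + gamma^2 = 2 (gamma^2 - gamma +
    1). *)
Lemma dvdot_smarandache_etg_velocity (e t g : R -> dvec) (V gamma : R -> dnum) (u : R) :
  dual_frame_facts e t g V gamma u ->
  let k := RtoD (1 / sqrt 3) in
  dvdot (dvderive (smarandache_etg e t g) u) (dvderive (smarandache_etg e t g) u)
  = RtoD 2 * (k * V u) ^ 2 * (gamma u ^ 2 - gamma u + RtoD 1).
Proof.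
intros hF k; rewrite (is_dvderive_unique (is_dvderive_smarandache_etg hF)).
rewrite (dvdot_frame_comb _ _ _ _ _ _ hF), RtoD_2; fold k; simpl dpow; ring.
Qed.

(** Completing the square leaves 3/4. This gives both the regularity of the Smarandache curve and a
    positive base for the 3/2 power. *)
Lemma re_quadratic_pos (x : dnum) : (0 < re (x ^ 2 - x + RtoD 1)%D)%R.
Proof. simpl; assert (h := Rle_0_sqr (re x - / 2)); unfold Rsqr in h; lra. Qed.

Lemma inv_sqrt3_pos : (0 < 1 / sqrt 3)%R.
Proof. apply Rdiv_lt_0_compat; [lra | apply sqrt_lt_R0; lra]. Qed.

Lemma smarandache_etg_twice_differentiable (a b : Rbar) (e t g : R -> dvec)
    (V gamma : R -> dnum) :
  (forall u, in_itv a b u -> dual_frame_facts e t g V gamma u) ->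
  (forall u, in_itv a b u -> (0 < re (V u))%R) ->
  (forall u, in_itv a b u -> ex_dderive V u) ->
  (forall u, in_itv a b u -> ex_dderive gamma u) ->
  twice_differentiable_spherical a b (smarandache_etg e t g).
Proof.
intros hF hV hdV hdg; constructor; intros u hu.
- exact (dvdot_smarandache_etg (hF u hu)).
- eexists; exact (is_dvderive_smarandache_etg (hF u hu)).
- destruct (hdV u hu) as [V' hV'], (hdg u hu) as [g' hg'].
  eexists; exact (is_dvderive2_smarandache_etg hF hu hV' hg').
(* A vanishing real velocity would make the real part of its squared dual norm 0, against the
   positivity of every factor in the formula. *)
- intros h0; assert (h := dvdot_smarandache_etg_velocity (hF u hu)); cbv zeta in h.
  assert (h1 := re_quadratic_pos (gamma u)); assert (h2 := hV u hu).
  assert (h3 : (0 < re (RtoD (1 / sqrt 3)))%R) by exact inv_sqrt3_pos.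
  apply (f_equal (@re R)) in h.
  change (re (dvdot (dvderive (smarandache_etg e t g) u) (dvderive (smarandache_etg e t g) u)))
    with (vdot (re (dvderive (smarandache_etg e t g) u))
      (re (dvderive (smarandache_etg e t g) u))) in h.
  rewrite h0 in h.
  replace (vdot vzero vzero) with 0%R in h by (unfold vdot; simpl; ring).
  revert h; apply Rlt_not_eq.
  set (q := gamma u ^ 2 - gamma u + RtoD 1) in *.
  set (k := RtoD (1 / sqrt 3)) in *; clearbody q k; simpl.
  repeat apply Rmult_lt_0_compat; try assumption; lra.
Qed.

Theorem theorem5p21 (a b : Rbar)
    (e t g : R -> dvec) (s : R -> R) (sb gamma : R -> dnum)
    (He : regular_dual_spherical_curve a b e)
    (Hframe : dual_darboux a b e s sb t g gamma)
    (t4 g4 : R -> dvec) (s4 : R -> R) (sb4 gamma4 : R -> dnum)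
    (Hframe4 : dual_darboux a b (smarandache_etg e t g) s4 sb4 t4 g4 gamma4) :
  forall u : R, in_itv a b u ->
    gamma4 u =
      ((RtoD 3 * ddsb s sb gamma u + RtoD 2 * gamma u ^ 3 + RtoD 2)
       / (RtoD (2 * sqrt 2)
          * dRpower (gamma u ^ 2 - gamma u + RtoD 1) (3 / 2)))%D.
Proof.
intros u hu.
assert (he := regular_twice_differentiable He).
assert (hF := fun v hv => @dual_darboux_frame_facts a b e s sb t g gamma v he Hframe hv).
assert (hV := fun v hv => @dspeed_pos a b e v he hv).
assert (hdV := fun v hv => @ex_dderive_dspeed a b e v he hv).
(* The second derivative of the Smarandache curve contains the derivative of gamma; the third
   derivative of [e] provides it. *)
assert (hdg : forall v, in_itv a b v -> ex_dderive gamma v).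
{ intros v hv; apply (ex_dderive_spherical_curvature he Hframe hv).
  apply (fun h => dvsmooth_on_ex_dvderive h hv).
  apply dvsmooth_on_dvderive, dvsmooth_on_dvderive, (rdsc_smooth He). }
assert (he4 := smarandache_etg_twice_differentiable hF hV hdV hdg).
assert (hdet := spherical_curvature_det he4 Hframe4 hu).
assert (hsq : dspeed (smarandache_etg e t g) u * dspeed (smarandache_etg e t g) u
  = RtoD 2 * (RtoD (1 / sqrt 3) * dspeed e u) ^ 2 * (gamma u ^ 2 - gamma u + RtoD 1))
  by exact (eq_trans (dvnorm_square (tds_regular he4 hu))
    (dvdot_smarandache_etg_velocity (hF u hu))).
assert (hgp := ddsb_dspeed gamma he Hframe hu).
rewrite (is_dvderive_unique (is_dvderive2_smarandache_etg hF hu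
  (ex_dderive_correct (hdV u hu)) (ex_dderive_correct (hdg u hu)))) in hdet.
rewrite (is_dvderive_unique (is_dvderive_smarandache_etg (hF u hu))), smarandache_etg_comb,
  dvdet_comb, (dff_det (hF u hu)), hgp in hdet.
assert (hV4 := dspeed_pos he4 hu); assert (hVu := hV u hu).
assert (hD := re_quadratic_pos (gamma u)); assert (hk := inv_sqrt3_pos).
assert (hP2 := dRpower_three_halves_square hD).
assert (hP : (0 < re (dRpower (gamma u ^ 2 - gamma u + RtoD 1)%D (3 / 2)))%R)
  by apply exp_pos.
assert (hc2 : RtoD (2 * sqrt 2) * RtoD (2 * sqrt 2) = RtoD 2 * RtoD 2 * RtoD 2).
{ rewrite <- !RtoD_mult; f_equal; assert (h := sqrt_sqrt 2 ltac:(lra)).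
  transitivity (4 * (sqrt 2 * sqrt 2))%R; [ring | rewrite h; ring]. }
assert (hc : (0 < re (RtoD (2 * sqrt 2)))%R)
  by (simpl; assert (h := sqrt_lt_R0 2 ltac:(lra)); lra).
assert (hk' : (0 < re (RtoD (1 / sqrt 3)))%R) by exact hk.
set (P := dRpower _ _) in *; set (c := RtoD (2 * sqrt 2)) in *.
set (D := gamma u ^ 2 - gamma u + RtoD 1) in *.
set (k := RtoD (1 / sqrt 3)) in *.
set (V4 := dspeed (smarandache_etg e t g) u) in *; set (V := dspeed e u) in *.
clearbody P c D k V4 V.
(* Both sides have positive real part and the same square 8 (k V)^6 D^3, since c^2 = 8 and P^2 =
   D^3. *)
assert (hV43 : V4 * V4 * V4 = (k * V) ^ 3 * (c * P)).
{ apply dsquare_inj.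
  - simpl; repeat apply Rmult_lt_0_compat; assumption.
  - simpl; repeat apply Rmult_lt_0_compat; try assumption; lra.
  - transitivity ((V4 * V4) * (V4 * V4) * (V4 * V4)); [ring |].
    transitivity ((k * V) ^ 3 * (k * V) ^ 3 * (c * c) * (P * P)); [| ring].
    rewrite hsq, hc2, hP2; simpl dpow; ring. }
assert (hkV : re ((k * V) ^ 3) <> 0%R).
{ simpl; apply Rgt_not_eq; repeat apply Rmult_lt_0_compat; try assumption; lra. }
assert (hcP : re (c * P) <> 0%R).
{ simpl; apply Rgt_not_eq, Rmult_lt_0_compat; assumption. }
(* After cancelling (k V)^3 this is the determinant formula for the second curve. The terms in V'
   disappear because they form a multiple of the velocity, another entry of the determinant. *)
assert (hmain : gamma4 u * (c * P)
  = RtoD 3 * ddsb s sb gamma u + RtoD 2 * gamma u ^ 3 + RtoD 2).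
{ apply (dmul_reg_l hkV).
  transitivity (gamma4 u * ((k * V) ^ 3 * (c * P))); [ring |].
  rewrite <- hV43, hdet, RtoD_2, RtoD_3; simpl dpow; ring. }
rewrite <- hmain; unfold ddiv.
transitivity (gamma4 u * (dinv (c * P) * (c * P))); [| ring].
rewrite (dinv_l hcP); ring.
Qed.
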